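(* Let $N\ge 2$, $\gamma\in\mathbb{R}\setminus\{0\}$, $s>0$, $\ell>0$, and let $\mathcal{C}^\gamma\in\mathbb{R}^{N\times N}$ be the gauge capacitance matrix of a chain of $N$ identical, equally spaced resonators of length $\ell$ and spacing $s$. Let $V=\ell\, I_N$. The eigenvalues of the eigenvalue problem $\mathcal{C}^\gamma \boldsymbol{a}=\lambda V\boldsymbol{a}$ are $$\lambda_1=0,\qquad \lambda_k=\frac{\gamma}{s}\coth\!\left(\frac{\gamma\ell}{2}\right)+\frac{2|\gamma|}{s}\,\frac{e^{\gamma\ell/2}}{|e^{\gamma\ell}-1|}\cos\!\left(\frac{\pi}{N}(k-1)\right),\quad 2\le k\le N.$$ Furthermore, for $2\le k\le N$, the associated eigenvectors $\boldsymbol{a}_k$ (suitably scaled) satisfy $$|\boldsymbol{a}_k^{(i)}|\le \kappa_k\, e^{-\gamma\ell\frac{i-1}{2}}\qquad\text{for all }1\le i\le N,$$ for some $\kappa_k\le (1+e^{\gamma\ell/2})^2$, where $\boldsymbol{a}_k^{(i)}$ denotes the $i$-th component of $\boldsymbol{a}_k$.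
   Context: For a chain of $N$ identical equally spaced resonators (all of length $\ell$, all consecutive spacings equal to $s$), the gauge capacitance matrix $\mathcal{C}^\gamma$ is the tridiagonal $N\times N$ matrix with entries $\mathcal{C}^\gamma_{1,1}=\frac{\gamma\ell}{s}\frac{1}{1-e^{-\gamma\ell}}$; $\mathcal{C}^\gamma_{i,i}=\frac{\gamma\ell}{s}\coth(\gamma\ell/2)$ for $1<i<N$; $\mathcal{C}^\gamma_{N,N}=-\frac{\gamma\ell}{s}\frac{1}{1-e^{\gamma\ell}}$; $\mathcal{C}^\gamma_{j+1,j}=\frac{\gamma\ell}{s}\frac{1}{1-e^{\gamma\ell}}$ and $\mathcal{C}^\gamma_{j,j+1}=-\frac{\gamma\ell}{s}\frac{1}{1-e^{-\gamma\ell}}$ for $1\le j\le N-1$; all other entries are zero. *)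

(* Defs.v *)
From HB Require Import structures.
From mathcomp Require Import all_boot all_order all_algebra.
From mathcomp Require Import complex.
From mathcomp Require Import all_classical all_reals all_analysis.

Set Implicit Arguments.
Unset Strict Implicit.
Unset Printing Implicit Defensive.

Import Order.TTheory GRing.Theory Num.Theory.

Local Open Scope ring_scope.
Local Open Scope complex_scope.

Definition coth (R : realType) (x : R) : R :=
  (expR x + expR (- x)) / (expR x - expR (- x)).

(* The indices i, j : 'I_N are 0-based. Intended for N >= 2: for N = 1 the first
   and last diagonal entries coincide. *)
Definition gauge_capacitance (R : realType) (N : nat) (gamma s l : R) :
    'M[R]_N :=
  \matrix_(i < N, j < N)
    if i == j :> nat then
      if i == 0%N :> nat then gamma * l / s * (1 / (1 - expR (- (gamma * l))))
      else if i.+1 == N then - (gamma * l / s * (1 / (1 - expR (gamma * l))))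
      else gamma * l / s * coth (gamma * l / 2)
    else if i == j.+1 :> nat then
      gamma * l / s * (1 / (1 - expR (gamma * l)))
    else if j == i.+1 :> nat then
      - (gamma * l / s * (1 / (1 - expR (- (gamma * l)))))
    else 0.

(* Real matrices are viewed over R[i], so that non-real eigenvalues and
   eigenvectors are not excluded a priori. *)
Definition gen_eigenvector (R : realType) (N : nat) (A V : 'M[R]_N)
    (mu : R[i]) (a : 'cV[R[i]]_N) : Prop :=
  a != 0 /\
  map_mx (real_complex R) A *m a = mu *: (map_mx (real_complex R) V *m a).

Definition gen_eigenvalue (R : realType) (N : nat) (A V : 'M[R]_N)
    (mu : R[i]) : Prop :=
  exists a : 'cV[R[i]]_N, gen_eigenvector A V mu a.

(* 1-based: meant for 1 <= k <= N. *)
Definition skin_eigenvalue (R : realType) (N : nat) (gamma s l : R) (k : nat) :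
    R :=
  if k == 1%N then 0
  else gamma / s * coth (gamma * l / 2)
       + 2 * `|gamma| / s
         * (expR (gamma * l / 2) / `|expR (gamma * l) - 1|)
         * cos (pi / N%:R * (k%:R - 1)).

(* Main.v *)
(** With q = e^(gamma l) and E = e^(gamma l / 2), every row of the matrix is, up
    to one common factor, a |-> (1 + q) a_i - a_(i-1) - q a_(i+1) with Neumann
    conditions a_(-1) = a_0 and a_N = a_(N-1). Conjugating by (-E)^i turns it
    into a constant-coefficient symmetric recurrence, solved by sines of
    frequency phi = pi (k - 1) / N; together with the constant vector this gives
    N eigenvectors with pairwise distinct eigenvalues, hence the whole spectrum.
    A solution of the recurrence is determined by its first entry, so the
    eigenspaces are lines and every eigenvector for the k-th eigenvalue is a
    multiple of the explicit one, which is bounded by (1 + E) E^(-i). *)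

Require Import Defs.
From mathcomp Require Import all_boot all_order all_algebra.
From mathcomp Require Import complex.
From mathcomp Require Import all_classical all_reals all_analysis.
From mathcomp Require Import ring lra zify.

Import Order.TTheory GRing.Theory Num.Theory.
Local Open Scope ring_scope.
Local Open Scope complex_scope.

(** Each such scalar is a root of the characteristic polynomial of [A^T], which has degree [n]. The
    transpose appears because library eigenvectors are rows. *)
Lemma size_column_eigenvalues_le (F : fieldType) (n : nat) (A : 'M[F]_n)
    (rs : seq F) :
  uniq rs ->
  (forall c, c \in rs -> exists2 a : 'cV[F]_n, a != 0 & A *m a = c *: a) ->
  (size rs <= n)%N.
Proof.
move=> rs_uniq rs_eig.
rewrite -ltnS -(size_char_poly A^T); apply: max_poly_roots => //.
  exact: monic_neq0 (char_poly_monic _).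
apply/allP => c /rs_eig[a a0 Aa]; rewrite -eigenvalue_root_char.
apply/eigenvalueP; exists a^T; last by rewrite trmx_eq0.
by rewrite -trmx_mul Aa linearZ.
Qed.

(** * The gauge capacitance matrix as a Neumann difference operator *)

(* Clamping the neighbours of the end points to the end points themselves
   encodes the discrete Neumann boundary conditions, so that a single formula
   describes all rows of the matrix. *)
Definition prev_site {n : nat} (i : 'I_n.+1) : 'I_n.+1 := inord i.-1.
Definition next_site {n : nat} (i : 'I_n.+1) : 'I_n.+1 := inord (minn i.+1 n).

Lemma prev_siteE (n : nat) (i : 'I_n.+1) : prev_site i = i.-1 :> nat.
Proof. by rewrite inordK //; case: i => i /=; lia. Qed.

Lemma next_siteE (n : nat) (i : 'I_n.+1) : next_site i = minn i.+1 n :> nat.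
Proof. by rewrite inordK //; lia. Qed.

Definition gauge_weight {R : realType} (gamma s l : R) : R :=
  gamma * l / s / (expR (gamma * l) - 1).

Lemma expR_sub1_neq0 (R : realType) (x : R) : x != 0 -> expR x - 1 != 0.
Proof.
by move=> x0; rewrite subr_eq0 -expR0; apply: contra_neq x0 => /expR_inj.
Qed.

Lemma expR_half_sqr (R : realType) (x : R) : expR (x / 2) ^+ 2 = expR x.
Proof.
by rewrite -expRM_natl -[_ *+ _]mulr_natr; congr expR; field.
Qed.

Lemma cothE (R : realType) (x : R) : x != 0 ->
  coth (x / 2) = (expR x + 1) / (expR x - 1).
Proof.
move=> x0; rewrite /coth expRN.
rewrite -(expR_half_sqr _ x).
have E1 : expR (x / 2) - 1 != 0.
  by apply: expR_sub1_neq0; rewrite mulf_neq0 // invr_eq0 pnatr_eq0.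
have E0 := expR_gt0 (x / 2).
have E2 : expR (x / 2) ^+ 2 - 1 != 0.
  by rewrite subr_sqr_1 mulf_neq0 //; lra.
by field; rewrite E2 /=; lra.
Qed.

(** Write w for the weight and q for e^(gamma l). The entries below and above the diagonal are -w
    and -w q, and coth(gamma l / 2) = (q + 1) / (q - 1). In an end row the clamped neighbour falls
    on the diagonal, leaving w q at the top and w at the bottom. *)
Lemma gauge_capacitanceE (R : realType) (n : nat) (gamma s l : R)
    (i j : 'I_n.+2) : s != 0 -> gamma * l != 0 ->
  gauge_capacitance n.+2 gamma s l i j =
  gauge_weight gamma s l * ((1 + expR (gamma * l)) * (j == i)%:R
    - (j == prev_site i)%:R - expR (gamma * l) * (j == next_site i)%:R).
Proof.
move=> s0 gl0; rewrite mxE /gauge_weight cothE // expRN.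
have := expR_sub1_neq0 _ _ gl0.
have := lt0r_neq0 (expR_gt0 (gamma * l)); move: (expR _) => q q0 q1.
have q1' : 1 - q != 0 by rewrite -opprB oppr_eq0.
rewrite -!val_eqE /= prev_siteE next_siteE.
case: i j => [i lti] [j ltj] /=.
have [-> {ltj} | ij] := eqVneq j i; last first.
  have [ij' | ij'] := eqVneq i j.+1.
    have -> : j == i.-1 by lia.
    have /negPf -> : j != minn i.+1 n.+1 by lia.
    by rewrite /=; field; rewrite ?q0 ?q1 ?q1' ?s0.
  have /negPf -> : j != i.-1 by lia.
  have -> : (j == minn i.+1 n.+1) = (j == i.+1) by lia.
  case: eqP => _ /=; last by ring.
  by field; rewrite ?q0 ?q1 ?q1' ?s0.
have [-> | i0] := eqVneq i 0%N.
  have /negPf -> : 0%N != minn 1 n.+1 by lia.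
  by rewrite /=; field; rewrite ?q0 ?q1 ?q1' ?s0.
have /negPf -> : i != i.-1 by lia.
rewrite eqSS; have [-> | iN] := eqVneq i n.+1.
  have -> : n.+1 == minn n.+2 n.+1 by lia.
  by rewrite /=; field; rewrite ?q0 ?q1 ?q1' ?s0.
have /negPf -> : i != minn i.+1 n.+1 by lia.
by rewrite /=; field; rewrite ?q0 ?q1 ?q1' ?s0.
Qed.

Lemma sum_mul_indicator (K : nzRingType) (n : nat) (k : 'I_n) (f : 'I_n -> K) :
  \sum_j (j == k)%:R * f j = f k.
Proof.
rewrite (bigD1 k) //= eqxx mul1r big1 ?addr0 // => j /negPf ->.
by rewrite mul0r.
Qed.

Lemma gauge_capacitance_mulE (R : realType) (n : nat) (gamma s l : R)
    (a : 'cV[R[i]]_n.+2) (i : 'I_n.+2) : s != 0 -> gamma * l != 0 ->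
  (map_mx (real_complex R) (gauge_capacitance n.+2 gamma s l) *m a) i 0 =
  (gauge_weight gamma s l)%:C * ((1 + (expR (gamma * l))%:C) * a i 0
    - a (prev_site i) 0 - (expR (gamma * l))%:C * a (next_site i) 0).
Proof.
move=> s0 gl0; rewrite mxE.
rewrite -(sum_mul_indicator _ _ i (fun k => a k 0)).
rewrite -(sum_mul_indicator _ _ (prev_site i) (fun k => a k 0)).
rewrite -(sum_mul_indicator _ _ (next_site i) (fun k => a k 0)).
rewrite !mulr_sumr -!sumrB mulr_sumr; apply: eq_bigr => j _.
rewrite mxE gauge_capacitanceE //.
rewrite !(rmorphM, rmorphB, rmorphD, rmorph_nat, rmorph1) /=; ring.
Qed.

Lemma gen_eigenvectorE (R : realType) (n : nat) (gamma s l : R) (mu : R[i])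
    (a : 'cV[R[i]]_n.+2) : s != 0 -> gamma * l != 0 ->
  gen_eigenvector (gauge_capacitance n.+2 gamma s l) l%:M mu a <->
  a != 0 /\ forall i, (gauge_weight gamma s l)%:C *
    ((1 + (expR (gamma * l))%:C) * a i 0
      - a (prev_site i) 0 - (expR (gamma * l))%:C * a (next_site i) 0) =
    mu * l%:C * a i 0.
Proof.
move=> s0 gl0; rewrite /gen_eigenvector map_scalar_mx mul_scalar_mx scalerA.
split=> -[a0 eqa]; split=> //.
  by move=> i; rewrite -gauge_capacitance_mulE // eqa mxE.
apply/matrixP => i j; rewrite ord1 gauge_capacitance_mulE // eqa.
by rewrite !mxE.
Qed.

(** * The three-term recurrence and its sine solutions *)

(* A solution of the three-term recurrence is determined by its first entry,
   so the eigenspaces are lines. *)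
Lemma neumann_recurrence_eq0 (K : fieldType) (n : nat) (w p q c : K)
    (a : 'I_n.+1 -> K) :
  w != 0 -> q != 0 ->
  (forall i, w * (p * a i - a (prev_site i) - q * a (next_site i)) = c * a i) ->
  a ord0 = 0 -> forall i, a i = 0.
Proof.
move=> w0 q0 eqa a0; case=> i; elim/ltn_ind: i => -[_ | i IH] lti.
  by rewrite -[RHS]a0; congr a; apply: val_inj.
have lti' := ltnW lti; have := eqa (Ordinal lti').
(* At site 0 the clamped predecessor is the site itself, so strong induction covers this case
   too. *)
have -> : a (prev_site (Ordinal lti')) = 0.
  have := prev_siteE _ (Ordinal lti'); case: (prev_site _) => k ltk /= ke.
  by apply: IH; lia.
rewrite (IH i) //.
have -> : next_site (Ordinal lti') = Ordinal lti.
  by apply: val_inj; rewrite /= next_siteE /=; lia.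
rewrite !mulr0 subrr sub0r => /eqP.
by rewrite mulrN oppr_eq0 !mulf_eq0 (negPf w0) (negPf q0) => /eqP.
Qed.

(* With x i = r^-i * (S i - r * S (i + 1)) and S i = sin (i * phi), the
   differences x i - x (i - 1) are proportional to r^-i * S i and therefore
   vanish at both ends of the chain; here r = -E. *)
Definition skin_mode {R : realType} (E phi : R) (i : nat) : R :=
  (- E) ^- i * (sin (i%:R * phi) + E * sin (i.+1%:R * phi)).

Lemma sin_recurrence (R : realType) (phi : R) (i : nat) :
  sin (i.+2%:R * phi) = 2 * cos phi * sin (i.+1%:R * phi) - sin (i%:R * phi).
Proof.
have -> : i.+2%:R * phi = i.+1%:R * phi + phi by rewrite -[in LHS]natr1; ring.
have -> : i%:R * phi = i.+1%:R * phi - phi by rewrite -natr1; ring.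
by rewrite sinB sinD; ring.
Qed.

Lemma skin_mode_recurrence (R : realType) (n : nat) (E phi : R)
    (i : 'I_n.+2) : E != 0 -> sin (n.+2%:R * phi) = 0 ->
  (1 + E ^+ 2) * skin_mode E phi i - skin_mode E phi (prev_site i)
    - E ^+ 2 * skin_mode E phi (next_site i) =
  (1 + E ^+ 2 + 2 * E * cos phi) * skin_mode E phi i.
Proof.
move=> E0 sinN; rewrite prev_siteE next_siteE /skin_mode.
case: i => -[_ | i lti] /=.
  have -> : minn 1 n.+1 = 1%N by lia.
  rewrite sin_recurrence mul0r sin0 mul1r expr0 expr1.
  by field; rewrite ?oppr_eq0 ?E0.
have r0 : (- E) ^+ i != 0 by rewrite expf_neq0 ?oppr_eq0.
(* The site is [i.+1], so [i = n] is the right end. There the vanishing of sin((n + 2) phi) gives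
   sin(n phi) = 2 cos(phi) sin((n + 1) phi). *)
have [iN | iN] := eqVneq i n.
  rewrite {}iN in r0 *; have -> : minn n.+2 n.+1 = n.+1 by lia.
  rewrite sinN [(- E) ^+ _.+1]exprS.
  move: sinN; rewrite sin_recurrence => /eqP; rewrite subr_eq0 => /eqP <-.
  by field; rewrite ?oppr_eq0 ?E0 ?r0.
have -> : minn i.+2 n.+1 = i.+2 by move: iN lti; lia.
rewrite [in sin (i.+3%:R * _)]sin_recurrence !sin_recurrence ![(- E) ^+ _.+1]exprS.
by field; rewrite ?oppr_eq0 ?E0 ?r0.
Qed.

Lemma skin_mode_le (R : realType) (E phi : R) (i : nat) : 0 < E ->
  `|skin_mode E phi i| <= (1 + E) * E ^- i.
Proof.
move=> E0; rewrite /skin_mode normrM normfV normrX normrN (gtr0_norm E0) mulrC.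
rewrite ler_wpM2r ?invr_ge0 ?exprn_ge0 ?(ltW E0) //.
apply: (le_trans (ler_normD _ _)); rewrite lerD //.
  by rewrite ler_norml sin_geN1 sin_le1.
rewrite normrM (gtr0_norm E0) ler_piMr ?(ltW E0) //.
by rewrite ler_norml sin_geN1 sin_le1.
Qed.

(** * Phases, eigenvalues and eigenvectors *)

Lemma gauge_weight_neq0 (R : realType) (gamma s l : R) :
  s != 0 -> gamma * l != 0 -> gauge_weight gamma s l != 0.
Proof.
move=> s0 gl0; rewrite /gauge_weight mulf_neq0 ?invr_eq0 ?expR_sub1_neq0 //.
by rewrite mulf_neq0 ?invr_eq0.
Qed.

Definition skin_phase (R : realType) (N k : nat) : R :=
  pi / N%:R * (k%:R - 1).

(** On this open interval sine is positive, so modes have a nonzero first entry, and cosine is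
    injective, so eigenvalues are distinct. *)
Lemma skin_phase_itv (R : realType) (N k : nat) : (2 <= k <= N)%N ->
  0 < skin_phase R N k < pi.
Proof.
case: k => // k /andP[k1 kN]; rewrite /skin_phase -natr1 addrK.
have pi0 := pi_gt0 R; have N0 : (0 : R) < N%:R by rewrite ltr0n; lia.
rewrite mulr_gt0 ?(divr_gt0 pi0 N0) ?ltr0n //=.
by rewrite mulrAC ltr_pdivrMr // ltr_pM2l // ltr_nat.
Qed.

Lemma sin_natmul_pi (R : realType) (n : nat) : sin (n%:R * pi) = 0 :> R.
Proof.
elim: n => [|n IH]; first by rewrite mul0r sin0.
by rewrite -natr1 mulrDl mul1r sinD IH sinpi mul0r mulr0 addr0.
Qed.

Lemma sin_skin_phase (R : realType) (N k : nat) : (2 <= k <= N)%N ->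
  sin (N%:R * skin_phase R N k) = 0.
Proof.
case: k => // k /andP[k1 kN]; rewrite /skin_phase -natr1 addrK.
rewrite (_ : _ * _ = k%:R * pi) ?sin_natmul_pi //.
by field; rewrite pnatr_eq0; lia.
Qed.

(** Since [l > 0], [gamma] and e^(gamma l) - 1 have the same sign, so the absolute values cancel in
    their quotient. The factor [l] comes from V = l I. *)
Lemma skin_eigenvalueE (R : realType) (N k : nat) (gamma s l : R) :
  gamma != 0 -> 0 < l -> s != 0 -> (2 <= k)%N ->
  skin_eigenvalue N gamma s l k * l =
  gauge_weight gamma s l * (1 + expR (gamma * l)
    + 2 * expR (gamma * l / 2) * cos (skin_phase R N k)).
Proof.
move=> g0 l0 s0 k2; have gl0 : gamma * l != 0 by rewrite mulf_neq0 // lt0r_neq0.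
rewrite /skin_eigenvalue ifN ?gtn_eqF //.
rewrite /gauge_weight cothE // -/(skin_phase R N k).
have q1 := expR_sub1_neq0 _ _ gl0.
have -> : 2 * `|gamma| / s * (expR (gamma * l / 2) / `|expR (gamma * l) - 1|) =
    2 / s * expR (gamma * l / 2) * `|gamma / (expR (gamma * l) - 1)|.
  by rewrite normf_div; field; rewrite normr_eq0 q1 s0.
rewrite ger0_norm; first by field; rewrite q1 s0.
case: (ltgtP gamma 0) g0 => // g0 _.
  by rewrite ltW // nmulr_rgt0 // invr_lt0 subr_lt0 expR_lt1 nmulr_rlt0.
by rewrite ltW // divr_gt0 // subr_gt0 expR_gt1 mulr_gt0.
Qed.

Lemma skin_mode0_gt0 (R : realType) (E phi : R) : 0 < E -> 0 < phi < pi ->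
  0 < skin_mode E phi 0.
Proof.
move=> E0 phi_itv; rewrite /skin_mode expr0 invr1 !mul1r mul0r sin0 add0r.
by rewrite mulr_gt0 // sin_gt0_pi.
Qed.

Lemma skin_mode_eigenvector (R : realType) (n k : nat) (gamma s l : R) :
  gamma != 0 -> 0 < l -> s != 0 -> (2 <= k <= n.+2)%N ->
  gen_eigenvector (gauge_capacitance n.+2 gamma s l) l%:M
    (skin_eigenvalue n.+2 gamma s l k)%:C
    (\col_i (skin_mode (expR (gamma * l / 2)) (skin_phase R n.+2 k) i)%:C).
Proof.
move=> g0 l0 s0 kN; have /andP[k2 _] := kN.
have gl0 : gamma * l != 0 by rewrite mulf_neq0 // lt0r_neq0.
have E0 := expR_gt0 (gamma * l / 2).
apply/gen_eigenvectorE => //; split=> [|i].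
  apply/eqP => /matrixP/(_ ord0 ord0); rewrite !mxE => /complexI/eqP.
  by rewrite gt_eqF // skin_mode0_gt0 ?skin_phase_itv.
rewrite !mxE -(rmorph1 (real_complex R)) -!(rmorphM, rmorphB, rmorphD) /=.
rewrite skin_eigenvalueE // -(expR_half_sqr _ (gamma * l)).
by rewrite skin_mode_recurrence ?lt0r_neq0 ?sin_skin_phase // mulrA.
Qed.

(** Every row sum is a multiple of (1 + q) - 1 - q = 0, end rows included thanks to the clamping. *)
Lemma const_eigenvector (R : realType) (n : nat) (gamma s l : R) :
  s != 0 -> gamma * l != 0 ->
  gen_eigenvector (gauge_capacitance n.+2 gamma s l) l%:M 0 (const_mx 1).
Proof.
move=> s0 gl0; apply/gen_eigenvectorE => //; split=> [|i]; last first.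
  by rewrite !mxE; ring.
by apply/eqP => /matrixP/(_ ord0 ord0); rewrite !mxE => /eqP; rewrite oner_eq0.
Qed.

Lemma skin_eigenvalue_inj (R : realType) (N : nat) (gamma s l : R) :
  gamma != 0 -> 0 < l -> s != 0 ->
  {in [pred k | (1 <= k <= N)%N] &, injective (skin_eigenvalue N gamma s l)}.
Proof.
move=> g0 l0 s0; have gl0 : gamma * l != 0 by rewrite mulf_neq0 // lt0r_neq0.
have w0 := gauge_weight_neq0 _ _ _ _ s0 gl0.
have E0 := expR_gt0 (gamma * l / 2).
(* Since cos(phi) > -1, the bracket 1 + E^2 + 2 E cos(phi) exceeds (E - 1)^2 >= 0. *)
have lam0 k : (2 <= k <= N)%N -> skin_eigenvalue N gamma s l k != 0.
  move=> /[dup] kN /andP[k2 _].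
  suff : skin_eigenvalue N gamma s l k * l != 0.
    by apply: contra_neq => ->; rewrite mul0r.
  rewrite skin_eigenvalueE // mulf_neq0 // gt_eqF // -(expR_half_sqr _ (gamma * l)).
  have /andP[phi0 phi_pi] := skin_phase_itv R _ _ kN.
  have : -1 < cos (skin_phase R N k).
    by rewrite -cospi ltr_cos // in_itv /= ?pi_ge0 ?lexx ?ltW.
  by move: (expR _) (cos _) E0 => E c E0 c1; have := sqr_ge0 (E - 1); nra.
move=> j k; rewrite !inE.
have [-> _ | j1 jN] := eqVneq j 1%N.
  have [-> // | k1 kN] := eqVneq k 1%N.
  move=> /esym/eqP; rewrite /skin_eigenvalue eqxx -/(skin_eigenvalue _ _ _ _ k).
  by rewrite (negPf (lam0 _ _)) //; lia.
have [-> _ | k1 kN] := eqVneq k 1%N.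
  move=> /eqP; rewrite [X in _ == X]/skin_eigenvalue eqxx.
  by rewrite (negPf (lam0 _ _)) //; lia.
move=> /(congr1 ( *%R^~ l)).
have jN' : (2 <= j <= N)%N by lia.
have kN' : (2 <= k <= N)%N by lia.
rewrite !skin_eigenvalueE //; try lia.
move=> /(mulfI w0)/addrI/mulfI.
rewrite mulf_neq0 ?pnatr_eq0 ?lt0r_neq0 // => /(_ isT)/cos_inj.
have /andP[pj0 pj1] := skin_phase_itv R _ _ jN'.
have /andP[pk0 pk1] := skin_phase_itv R _ _ kN'.
rewrite !in_itv /= !ltW // => /(_ isT isT)/mulfI.
rewrite mulf_neq0 ?invr_eq0 ?pnatr_eq0 ?lt0r_neq0 ?pi_gt0 //; last by lia.
by move=> /(_ isT)/addIr/eqP; rewrite eqr_nat => /eqP.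
Qed.

Theorem theorem3p1 (R : realType) (N : nat) (gamma s l : R)
    (hN : (2 <= N)%N) (hgamma : gamma != 0) (hs : 0 < s) (hl : 0 < l) :
  let C := gauge_capacitance N gamma s l in
  let V := l%:M : 'M[R]_N in
  let lambda := skin_eigenvalue N gamma s l in
  (forall mu : R[i],
     gen_eigenvalue C V mu <->
     exists k : nat, (1 <= k <= N)%N /\ mu = (lambda k)%:C) /\
  (forall k : nat, (2 <= k <= N)%N ->
     exists kappa : R,
       kappa <= (1 + expR (gamma * l / 2)) ^+ 2 /\
       forall a : 'cV[R[i]]_N, gen_eigenvector C V (lambda k)%:C a ->
         exists c : R[i], c != 0 /\
           (* i is 0-based, so it plays the role of i - 1 in the exponent *)
           forall i : 'I_N,
             `|(c *: a) i 0| <= (kappa * expR (- (gamma * l * (i%:R / 2))))%:C).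
Proof.
case: N hN => [|[|n]] // _ C V lambda.
have s0 := lt0r_neq0 hs; have l0 := lt0r_neq0 hl.
have gl0 : gamma * l != 0 by rewrite mulf_neq0.
have E0 := expR_gt0 (gamma * l / 2).
have eig_lambda k : (1 <= k <= n.+2)%N -> gen_eigenvalue C V (lambda k)%:C.
  have [-> _ | k1 kN] := eqVneq k 1%N.
    by eexists; rewrite /lambda /skin_eigenvalue eqxx; apply: const_eigenvector.
  by eexists; apply: skin_mode_eigenvector => //; lia.
split=> [mu | k kN].
  split=> [eig_mu | [k [kN ->]]]; last exact: eig_lambda.
  (* These are N distinct eigenvalues of [C] itself; a value [mu * l] outside the list would be one
     too many. *)
  pose rs := [seq (lambda k)%:C * l%:C | k <- iota 1 n.+2].
  have [/mapP[k] | rs_mu] := boolP (mu * l%:C \in rs).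
    rewrite mem_iota => kN /mulIf mu_k; exists k; split; first by lia.
    by apply: mu_k; rewrite (inj_eq (@complexI R) _ 0).
  suff : (size (mu * l%:C :: rs)%R <= n.+2)%N.
    by rewrite /= size_map size_iota ltnn.
  apply: (size_column_eigenvalues_le _ _ (map_mx (real_complex R) C)).
    rewrite cons_uniq rs_mu map_inj_in_uniq ?iota_uniq // => j k.
    rewrite !mem_iota => jN kN; rewrite -!rmorphM /= => /complexI/mulIf.
    move=> /(_ l0)/skin_eigenvalue_inj; apply => //; rewrite inE; lia.
  have eigP nu : gen_eigenvalue C V nu -> exists2 a : 'cV_n.+2,
      a != 0 & map_mx (real_complex R) C *m a = (nu * l%:C) *: a.
    move=> [a [a0 Ca]]; exists a => //.
    by rewrite Ca map_scalar_mx mul_scalar_mx scalerA.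
  move=> c; rewrite inE => /predU1P[-> | /mapP[k]]; first exact: eigP.
  by rewrite mem_iota => kN ->; apply/eigP/eig_lambda; lia.
set E := expR (gamma * l / 2) in E0 *.
have phi_itv := skin_phase_itv R _ _ kN; set phi := skin_phase R _ _ in phi_itv.
(* The constant of [skin_mode_le]; it is at most its own square because 1 + E >= 1. *)
exists (1 + E); split; first by rewrite expr2 ler_peMr; lra.
move=> a /[dup] eig_a /gen_eigenvectorE[] // a_neq0 a_rec.
have w0 : (gauge_weight gamma s l)%:C != 0 :> R[i].
  by rewrite (inj_eq (@complexI R) _ 0) gauge_weight_neq0.
have q0 : (expR (gamma * l))%:C != 0 :> R[i].
  by rewrite (inj_eq (@complexI R) _ 0) lt0r_neq0 // expR_gt0.
have [_ x_rec] := (gen_eigenvectorE _ _ _ _ _ _ _ s0 gl0).1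
  (skin_mode_eigenvector _ _ _ _ _ _ hgamma hl s0 kN).
have a00 : a ord0 0 != 0.
  apply: contra_neq a_neq0 => a00; apply/matrixP => i j; rewrite ord1 mxE.
  exact: (neumann_recurrence_eq0 _ _ _ _ _ _ (fun i => a i 0) w0 q0 a_rec a00).
(* This scaling matches the first entry of the explicit mode; the difference then solves the
   recurrence with first entry 0, hence vanishes. *)
pose c := (skin_mode E phi 0)%:C / a ord0 0.
have c0 : c != 0.
  rewrite mulf_neq0 ?invr_eq0 // (inj_eq (@complexI R) _ 0).
  by rewrite lt0r_neq0 // skin_mode0_gt0.
exists c; split=> // i.
have -> : (c *: a) i 0 = (skin_mode E phi i)%:C.
  apply/eqP; rewrite mxE -subr_eq0; apply/eqP.
  apply: (neumann_recurrence_eq0 _ _ _ (1 + (expR (gamma * l))%:C) _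
    ((lambda k)%:C * l%:C) (fun i => c * a i 0 - (skin_mode E phi i)%:C) w0 q0).
    move=> j; have := x_rec j; rewrite !mxE -/(lambda k) -/E -/phi => x_j.
    rewrite [RHS]mulrBr -x_j [in RHS]mulrCA -a_rec; ring.
  by rewrite /c divfK // subrr.
rewrite normc_def /= expr0n addr0 sqrtr_sqr lecR.
suff -> : expR (- (gamma * l * (i%:R / 2))) = E ^- i by apply: skin_mode_le.
by rewrite expRN /E -expRM_natl -[_ *+ _]mulr_natr; congr (expR _)^-1; field.
Qed.
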